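(* Let $G$ be a cubic graph containing no $4$-cycle, and let $\overline{S}\subseteq V(G)$ be such that for all distinct $u,v\in\overline{S}$, $u\notin T_2(v)\cup T_4(v)$. Then $S=V(G)\setminus\overline{S}$ is a DET:OLD set of $G$.
   Context: For a graph $G$ and $v\in V(G)$, $N(v)$ is the open neighborhood of $v$. For $S\subseteq V(G)$ write $N_S(v)=N(v)\cap S$. A set $S\subseteq V(G)$ is a DET:OLD set of $G$ if (1) every vertex $v$ satisfies $|N_S(v)|\ge 2$, and (2) every pair of distinct vertices $u,v$ satisfies $|N_S(u)\setminus N_S(v)|\ge 2$ or $|N_S(v)\setminus N_S(u)|\ge 2$. A cubic graph is a 3-regular simple graph. A trail of length $k$ is a walk $v_0v_1\cdots v_k$ whose $k$ edges $v_{i-1}v_i$ are pairwise distinct; $T_k(v)$ denotes the set of vertices $w$ such that there is a trail of length $k$ from $v$ to $w$. *)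

(* Defs.v *)
From HB Require Import structures.
From mathcomp Require Import all_boot all_classical.

Set Implicit Arguments.
Unset Strict Implicit.
Unset Printing Implicit Defensive.

Local Open Scope classical_set_scope.
Local Open Scope card_scope.

(* Simple graphs, finite or infinite.  By classical logic it is no restriction
   that the vertices form a [choiceType] and that adjacency is boolean. *)
Record sgraph := SGraph {
  vertex :> choiceType;
  adj : rel vertex;
  adj_sym : symmetric adj;
  adj_irrefl : irreflexive adj }.

Arguments adj : clear implicits.

Section Graph.
Variable G : sgraph.
Implicit Types (u v w : G) (S : set G).

Definition nbhd v : set G := [set w | adj G v w].

Definition nbhd_in S v : set G := nbhd v `&` S.

Definition cubic := forall v, nbhd v #= `I_3.

(* [ucycle] : consecutive vertices of [c] are adjacent, the last one is adjacent
   to the first, and the vertices are distinct.  The cycle need not be induced. *)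
Definition has_kcycle (k : nat) := exists c : seq G, size c = k /\ ucycle (adj G) c.

(* The walk with vertices [v :: p]; its length is [size p]. Edges are compared
   as unordered pairs. *)
Definition trail v (p : seq G) :=
  path (adj G) v p /\ uniq (pairmap (fun x y : G => [set x; y]) v p).

Definition trail_set (k : nat) v : set G :=
  [set w | exists p : seq G, [/\ size p = k, trail v p & last v p = w]].

Definition det_old S :=
  (forall v, `I_2 #<= nbhd_in S v) /\
  (forall u v, u <> v ->
     `I_2 #<= nbhd_in S u `\` nbhd_in S v \/
     `I_2 #<= nbhd_in S v `\` nbhd_in S u).

End Graph.

Arguments cubic : clear implicits.
Arguments has_kcycle : clear implicits.

(* Main.v *)
(** If a vertex had two neighbours outside [S], they would be joined by a trail
    of length 2; hence every vertex keeps two neighbours in [S].  As there is no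
    4-cycle, distinct [u] and [v] share at most one neighbour [w].  If both
    differences had at most one element, [u] and [v] would have neighbours
    [x <> w] and [y <> w] outside [S], and [x u w v y] would be a trail of
    length 4, unless [x = v] and [y = u], in which case [x w y] is a trail of
    length 2. *)
Require Import Defs.
From HB Require Import structures.
From mathcomp Require Import all_boot all_classical.

Set Implicit Arguments.
Unset Strict Implicit.
Unset Printing Implicit Defensive.

Local Open Scope classical_set_scope.
Local Open Scope card_scope.

Lemma card_ge2 (T : Type) (A : set T) (x y : T) :
  A x -> A y -> x <> y -> `I_2 #<= A.
Proof.
move=> Ax Ay xy; pose f (n : nat) := if n is 0 then x else y.
have fI : {in `I_2 &, injective f}.
  by move=> [|[|m]] [|[|n]] //; rewrite !inE //= => _ _ e; case: xy.
rewrite -(card_le_eql (inj_card_eq fI)); apply: subset_card_le.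
by move=> _ [[|n] _ <-].
Qed.

Lemma card_eq3 (T : Type) (A : set T) : A #= `I_3 ->
  exists a b c, [/\ A a, A b & A c] /\ [/\ a <> b, a <> c & b <> c].
Proof.
case/eq_cardSP=> a Aa /eq_cardSP[b [Ab ba]] /eq_cardSP[c [[Ac ca] cb]] _.
by exists a, b, c; split; split=> //; apply/nesym.
Qed.

Lemma set2_inj (T : Type) (a b c d : T) : [set a; b] = [set c; d] ->
  a = c /\ b = d \/ a = d /\ b = c.
Proof.
move=> e.
have : [set c; d] a by rewrite -e; left.
have : [set c; d] b by rewrite -e; right.
have : [set a; b] c by rewrite e; left.
have : [set a; b] d by rewrite e; right.
by move=> [] -> [] -> [] ? [] ?; auto.
Qed.

Section Trails.
Variable G : sgraph.
Implicit Types a b c d e u v : G.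

Lemma adj_neq u v : adj G u v -> u <> v.
Proof. by move=> uv e; move: uv; rewrite e adj_irrefl. Qed.

Lemma trail_set2 a b c : adj G a b -> adj G b c -> a <> c -> trail_set 2 a c.
Proof.
move=> ab bc ac; exists [:: b; c]; split=> //; split; first by rewrite /= ab bc.
rewrite /= !inE !andbT; apply/eqP => E; case: (set2_inj E) => [[e _]|[]] //.
exact: adj_neq ab e.
Qed.

(** The vertices may repeat; only the edges must differ. Consecutive edges differ by [a <> c],
    [b <> d], [c <> e]. The end edges could agree as [a = e], [b = d], which is excluded, or as
    [a = d], [b = e], hence the last hypothesis. *)
Lemma trail_set4 a b c d e :
  adj G a b -> adj G b c -> adj G c d -> adj G d e ->
  a <> c -> b <> d -> c <> e -> ~ (a = d /\ b = e) -> trail_set 4 a e.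
Proof.
move=> ab bc cd de ac bd ce H; exists [:: b; c; d; e]; split=> //.
split; first by rewrite /= ab bc cd de.
move: (adj_neq ab) (adj_neq bc) (adj_neq cd) (adj_neq de) => nab nbc ncd nde.
have ne (x y z t : G) : ~ (x = z /\ y = t) -> ~ (x = t /\ y = z) ->
    ([set x; y] == [set z; t]) = false.
  by move=> ? ?; apply/eqP => E; case: (set2_inj E).
by rewrite /= !inE !ne // => -[] ? ?; auto.
Qed.

(** Otherwise [u], [w], [v], [x] in this order form a 4-cycle. *)
Lemma no_4cycle_common_nbr u v w x : ~ has_kcycle G 4 -> u <> v ->
  adj G u w -> adj G v w -> adj G u x -> adj G v x -> x = w.
Proof.
move=> C4 uv uw vw ux vx; apply: contrapT => xw; apply: C4.
exists [:: u; w; v; x]; split=> //; apply/andP; split.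
  by rewrite /= uw adj_sym vw vx adj_sym ux.
move: (adj_neq uw) (adj_neq vw) (adj_neq ux) (adj_neq vx) => ? ? ? ?.
rewrite /= !inE !negb_or !andbT.
by do ![apply/andP; split]; apply/eqP; congruence.
Qed.

(** At most one of the three neighbours equals [w], which need not be adjacent to [v]. *)
Lemma cubic_other_nbrs v w : cubic G ->
  exists a b, [/\ adj G v a, adj G v b, a <> b, a <> w & b <> w].
Proof.
move=> /(_ v)/card_eq3[a [b [c [[va vb vc] [ab ac bc]]]]].
have [aw|aw] := pselect (a = w).
  by exists b, c; split=> // ?; congruence.
have [bw|bw] := pselect (b = w).
  by exists a, c; split=> // ?; congruence.
by exists a, b.
Qed.

End Trails.

Theorem theorem10 (G : sgraph) (Sbar : set G) :
  cubic G ->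
  ~ has_kcycle G 4 ->
  (forall u v : G, Sbar u -> Sbar v -> u <> v ->
     ~ (trail_set 2 v `|` trail_set 4 v) u) ->
  det_old (~` Sbar).
Proof.
move=> cub C4 far.
have uniq_nbr v a b : adj G v a -> adj G v b -> Sbar a -> Sbar b -> a = b.
  move=> va vb Sa Sb; apply: contrapT => ab.
  apply: (far _ _ Sb Sa) => [/esym//|]; left.
  by apply: (trail_set2 (b := v)); rewrite // adj_sym.
have dom v : `I_2 #<= nbhd_in (~` Sbar) v.
  have [w Pw] : exists w, forall x, adj G v x -> Sbar x -> x = w.
    have [[w [vw Sw]]|none] := pselect (exists w, adj G v w /\ Sbar w).
      by exists w => x vx Sx; exact: uniq_nbr vx vw Sx Sw.
    (* No neighbour lies in [Sbar], so [v] is only a default value. *)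
    by exists v => x vx Sx; case: none; exists x.
  have [a [b [va vb ab aw bw]]] := @cubic_other_nbrs G v w cub.
  by apply: (@card_ge2 _ _ a b) => //; split=> // ?; [apply: aw|apply: bw]; auto.
split=> // u v uv.
have [[w [uw vw]]|disj] := pselect (exists w, adj G u w /\ adj G v w); last first.
  (* Without a common neighbour, the difference loses nothing and [dom] suffices. *)
  left; apply: (card_le_trans (dom u)); apply: subset_card_le => x [ux Sx].
  by split=> // -[vx _]; apply: disj; exists x.
(* Stated for [s] and [t] because it serves both for [u], [v] and for [v], [u]. *)
have side s t : s <> t -> adj G s w -> adj G t w ->
    (forall x, adj G s x -> x <> w -> ~ Sbar x) ->
    `I_2 #<= nbhd_in (~` Sbar) s `\` nbhd_in (~` Sbar) t.
  move=> st sw tw noS; have [a [b [sa sb ab aw bw]]] := @cubic_other_nbrs G s w cub.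
  apply: (@card_ge2 _ _ a b) => //; (split; first by split=> //; apply: noS).
    by case=> ta _; apply: aw; exact: (no_4cycle_common_nbr C4 st).
  by case=> tb _; apply: bw; exact: (no_4cycle_common_nbr C4 st).
have [noS|/existsNP[x]] := pselect (forall x, adj G u x -> x <> w -> ~ Sbar x).
  by left; exact: side.
move=> /not_implyP[ux /not_implyP[xw /contrapT Sx]].
right; apply: side => // [/esym//|y vy yw Sy].
(* If [x = y], it would be a second common neighbour of [u] and [v]. *)
have xy : x <> y.
  by move=> xy; apply: xw; apply: (no_4cycle_common_nbr C4 uv) => //; rewrite xy.
apply: (far _ _ Sy Sx) => [/esym//|].
(* In the first case both end edges of the walk [x], [u], [w], [v], [y] are the edge joining [u] and
   [v]. *)
have [[xv uy]|H] := pselect (x = v /\ u = y).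
  by left; apply: (trail_set2 (b := w)) => //; rewrite ?xv -?uy // adj_sym.
right; apply: (@trail_set4 _ x u w v y); rewrite // 1?adj_sym //.
exact/nesym.
Qed.
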